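(* Let $X$ be a function space in the wide sense on $(\Omega,\Sigma,\mu,\Delta_X)$, let $Y$ be a Banach space and let $T:X\to Y$ be a compact operator. Suppose that $T^{**}$ is pointwise weak-* absolutely continuous. Then $T$ is absolutely continuous.
   Context: All Banach spaces are complex; $(\Omega,\Sigma,\mu)$ is a measure space. A Banach space $X$ is a function space in the wide sense on $(\Omega,\Sigma,\mu,\Delta_X)$ if $\Delta_X:\Sigma\times X\to X$ satisfies: (I) $\Delta_X(A\cap B,f)=\Delta_X(A,\Delta_X(B,f))$ for all $A,B\in\Sigma$, $f\in X$; (II) $f\mapsto\Delta_X(A,f)$ is linear for each $A\in\Sigma$; (III) $\Delta_X(A\cup B,f)=\Delta_X(A,f)+\Delta_X(B,f)$ if $A\cap B=\emptyset$; (IV) $\Delta_X(A,f)=0$ if $\mu(A)=0$, and $\Delta_X(\Omega,f)=f$; (V) there is $C>0$ with $\|\Delta_X(A,f)\|\le C\|f\|$ for all $A,f$. Let $\Delta_{X^*}^*(A,\cdot):X^*\to X^*$ be the adjoint of $\Delta_X(A,\cdot)$ and $\Delta_{X^{**}}^{**}(A,\cdot):X^{**}\to X^{**}$ its biadjoint. A bounded operator $T:X\to Y$ is absolutely continuous if for every $\varepsilon>0$ there is $\delta>0$ such that for every $A\in\Sigma$ with $\mu(A)<\delta$, the operator $f\mapsto T(\Delta_X(A,f))$ has norm $<\varepsilon$ in $\mathcal L(X,Y)$. A finitely additive set function $\nu$ on $\Sigma$ is $\mu$-countably additive if $\nu(\bigcup_kA_k)=\sum_k\nu(A_k)$ for every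 sequence $(A_k)_{k\ge0}$ of pairwise disjoint sets in $\Sigma$ with $\mu(\bigcup_kA_k)<\infty$. $T^{**}$ is pointwise weak-* absolutely continuous if for all $f^{**}\in X^{**}$ and $y^*\in Y^*$ the set function $A\mapsto\langle y^*,T^{**}(\Delta_{X^{**}}^{**}(A,f^{**}))\rangle$ is $\mu$-countably additive. *)

(* Defs.v *)
From HB Require Import structures.
From mathcomp Require Import all_boot all_order all_algebra.
From mathcomp Require Export complex.
From mathcomp Require Import all_classical all_reals all_analysis.

Set Implicit Arguments.
Unset Strict Implicit.
Unset Printing Implicit Defensive.

Import Order.TTheory GRing.Theory Num.Theory.
Import numFieldNormedType.Exports.

Local Open Scope classical_set_scope.
Local Open Scope ring_scope.
Local Open Scope complex_scope.

Section BoundedOperators.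
Context {R : realType} {X Y : normedModType R[i]}.

Definition bounded_linear : {pred X -> Y} := fun f =>
  `[< linear f /\ exists M : R, forall x, `|f x| <= M%:C * `|x| >].

Record bop := BOp { bop_fun :> X -> Y ; _ : bop_fun \in bounded_linear }.

HB.instance Definition _ := [isSub for bop_fun].
HB.instance Definition _ := [Choice of bop by <:].

Lemma bounded_linearP (f : X -> Y) : reflect
  (linear f /\ exists M : R, forall x, `|f x| <= M%:C * `|x|)
  (f \in bounded_linear).
Proof. exact: asboolP. Qed.

Lemma bopP (f : bop) :
  linear f /\ exists M : R, forall x, `|f x| <= M%:C * `|x|.
Proof. by case: f => f /= /bounded_linearP. Qed.

HB.instance Definition _ (f : bop) :=
  GRing.isLinear.Build R[i] X Y _ f (bopP f).1.

Lemma normc_real (V : normedModType R[i]) (x : V) :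
  (complex.Re `|x|)%:C = `|x|.
Proof.
have := normr_ge0 x; case: (`|x|) => a b.
by rewrite lecE /= => /andP[/eqP -> _].
Qed.

Lemma bounded_linear_submod : submod_closed bounded_linear.
Proof.
split.
  apply/bounded_linearP; split.
    by move=> a u v /=; rewrite /= !(fctE, scaler0, addr0).
  by exists 0 => x; rewrite normr0 mul0r.
move=> a f g /bounded_linearP[lf [M Mf]] /bounded_linearP[lg [N Ng]].
apply/bounded_linearP; split.
  move=> b u v; rewrite !fctE /= lf lg !scalerDr !scalerA (mulrC a b).
  by rewrite -!addrA; congr (_ + _); rewrite addrCA.
exists (complex.Re `|a| * M + N) => x.
rewrite !fctE (le_trans (ler_normD _ _))// rmorphD/= mulrDl lerD//.
rewrite normrZ rmorphM /= (@normc_real R[i]^o a) -mulrA.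
by rewrite ler_wpM2l.
Qed.

HB.instance Definition _ :=
  GRing.isSubmodClosed.Build R[i] (X -> Y) bounded_linear bounded_linear_submod.
HB.instance Definition _ := [SubChoice_isSubLmodule of bop by <:].

(* Norms on a [normedModType R[i]] take their (nonnegative real) values in
   R[i]; [complex.Re] brings them back to R, where suprema exist. *)
Definition bop_norm (f : bop) : R :=
  sup [set complex.Re `|f x| | x in [set x : X | `|x| <= 1]].

Lemma bop_norm_has_sup (f : bop) :
  has_sup [set complex.Re `|f x| | x in [set x : X | `|x| <= 1]].
Proof.
split; first by exists (complex.Re `|f 0|), 0 => //=; rewrite normr0 ler01.
have [_ [M Mf]] := bopP f.
exists (Num.max M 0) => _ [x /= x1 <-].
rewrite -lecR normc_real (le_trans (Mf x))//.
rewrite (@le_trans _ _ ((Num.max M 0)%:C * `|x|))//.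
  by rewrite ler_wpM2r// lecR le_max lexx.
by rewrite ler_piMr// (lecR 0) le_max lexx orbT.
Qed.

Lemma bop_norm_ge0 (f : bop) : 0 <= bop_norm f.
Proof.
have [_ ubf] := bop_norm_has_sup f.
have -> : 0 = complex.Re `|f 0| by rewrite linear0 normr0.
by apply: ub_le_sup => //; exists 0 => //=; rewrite normr0 ler01.
Qed.

Lemma le_bop_norm (f : bop) (x : X) : `|f x| <= (bop_norm f)%:C * `|x|.
Proof.
have [->|x0] := eqVneq x 0; first by rewrite linear0 !normr0 mulr0.
have nx0 : 0 < `|x| by rewrite normr_gt0.
rewrite -ler_pdivrMr// mulrC -[_^-1]ger0_norm ?invr_ge0// -normrZ -linearZ /=.
rewrite -(normc_real (f _)) lecR; have [_ ubf] := bop_norm_has_sup f.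
apply: ub_le_sup => //; exists (`|x|^-1 *: x) => //=.
by rewrite normrZ ger0_norm ?invr_ge0// mulVf// gt_eqF.
Qed.

Lemma bop_norm_le (f : bop) (M : R) :
  (forall x, `|x| <= 1 -> `|f x| <= M%:C) -> bop_norm f <= M.
Proof.
move=> fM; apply: ge_sup; first exact: (bop_norm_has_sup f).1.
by move=> _ [x /= x1 <-]; rewrite -lecR normc_real fM.
Qed.

Lemma bopDE (f g : bop) x : (f + g) x = f x + g x. Proof. by []. Qed.

Lemma bopZE (a : R[i]) (f : bop) x : (a *: f) x = a *: f x. Proof. by []. Qed.

Lemma ler_bop_normD (f g : bop) :
  (bop_norm (f + g))%:C <= (bop_norm f)%:C + (bop_norm g)%:C.
Proof.
rewrite -rmorphD lecR; apply: bop_norm_le => x x1.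
rewrite bopDE rmorphD (le_trans (ler_normD _ _))// lerD//;
by rewrite (le_trans (le_bop_norm _ _))// ler_piMr// (lecR 0) bop_norm_ge0.
Qed.

Lemma bop_normZ_le (a : R[i]) (f : bop) :
  (bop_norm (a *: f))%:C <= `|a| * (bop_norm f)%:C.
Proof.
rewrite -(@normc_real R[i]^o a) -rmorphM lecR; apply: bop_norm_le => x x1.
rewrite bopZE normrZ rmorphM /= (@normc_real R[i]^o a) ler_wpM2l//.
by rewrite (le_trans (le_bop_norm _ _))// ler_piMr// (lecR 0) bop_norm_ge0.
Qed.

Lemma bop_normZ (a : R[i]) (f : bop) :
  (bop_norm (a *: f))%:C = `|a| * (bop_norm f)%:C.
Proof.
apply/eqP; rewrite eq_le bop_normZ_le /=.
have [->|a0] := eqVneq a 0; first by rewrite normr0 mul0r (lecR 0) bop_norm_ge0.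
have a1 : 0 < `|a| by rewrite normr_gt0.
rewrite -ler_pdivlMl//.
have := bop_normZ_le a^-1 (a *: f).
by rewrite scalerA mulVf// scale1r normfV.
Qed.

Lemma bop_norm_eq0 (f : bop) : (bop_norm f)%:C = 0 -> f = 0.
Proof.
move=> f0; apply/val_inj/funext => x /=.
by apply/eqP; rewrite -normr_le0 (le_trans (le_bop_norm f x))// f0 mul0r.
Qed.

HB.instance Definition _ := @Lmodule_isNormed.Build R[i] bop
  (fun f => (bop_norm f)%:C) ler_bop_normD bop_normZ bop_norm_eq0.

Lemma bop_normE (f : bop) : `|f| = (bop_norm f)%:C. Proof. by []. Qed.

End BoundedOperators.
Arguments bop {R} X Y.
Arguments bounded_linear {R} X Y.

Section Composition.
Context {R : realType} {X Y Z : normedModType R[i]}.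

Lemma bounded_linear_comp (g : bop Y Z) (f : bop X Y) :
  g \o f \in bounded_linear X Z.
Proof.
apply/bounded_linearP; split.
  by move=> a u v /=; rewrite linearP linearP.
exists (bop_norm g * bop_norm f) => x /=.
rewrite (le_trans (le_bop_norm _ _))// rmorphM/= -mulrA.
by rewrite ler_wpM2l ?le_bop_norm// (lecR 0) bop_norm_ge0.
Qed.

Definition bop_comp (g : bop Y Z) (f : bop X Y) : bop X Z :=
  BOp (bounded_linear_comp g f).

End Composition.

Definition dual {R : realType} (X : normedModType R[i]) : normedModType R[i] :=
  bop X R[i]^o.

Section Adjoint.
Context {R : realType} {X Y : normedModType R[i]}.

Lemma bounded_linear_adjoint (T : bop X Y) :
  (fun y' : dual Y => bop_comp y' T : dual X)
    \in bounded_linear (dual Y) (dual X).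
Proof.
apply/bounded_linearP; split.
  by move=> a u v; apply/val_inj/funext => x.
exists (bop_norm T) => y'; rewrite -rmorphM lecR.
apply: bop_norm_le => x x1 /=.
rewrite (le_trans (le_bop_norm _ _))// rmorphM /= [leRHS]mulrC ler_wpM2l//.
  by rewrite (lecR 0) bop_norm_ge0.
by rewrite (le_trans (le_bop_norm _ _))// ler_piMr// (lecR 0) bop_norm_ge0.
Qed.

Definition adjoint (T : bop X Y) : bop (dual Y) (dual X) :=
  BOp (bounded_linear_adjoint T).

End Adjoint.

Definition biadjoint {R : realType} {X Y : normedModType R[i]} (T : bop X Y) :
  bop (dual (dual X)) (dual (dual Y)) := adjoint (adjoint T).

Definition compact_operator {R : realType} {X Y : normedModType R[i]}
    (T : bop X Y) : Prop :=
  precompact (T @` [set x | `|x| <= 1]).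

Section WideFunctionSpace.
Context {d : measure_display} {Omega : measurableType d} {R : realType}.
Context (mu : {measure set Omega -> \bar R}).

(* [wfs_delta A] is only constrained, and only meaningful, for measurable A. *)
Record wide_function_space (X : normedModType R[i]) := WideFunctionSpace {
  wfs_delta :> set Omega -> X -> X ;
  wfs_deltaI : forall A B f, measurable A -> measurable B ->
    wfs_delta (A `&` B) f = wfs_delta A (wfs_delta B f) ;
  wfs_delta_linear : forall A, measurable A -> linear (wfs_delta A) ;
  wfs_deltaU : forall A B f, measurable A -> measurable B ->
    A `&` B = set0 -> wfs_delta (A `|` B) f = wfs_delta A f + wfs_delta B f ;
  wfs_delta_null : forall A f, measurable A -> mu A = 0%E ->
    wfs_delta A f = 0 ;
  wfs_deltaT : forall f, wfs_delta setT f = f ;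
  wfs_delta_bounded : exists2 C : R, 0 < C &
    forall A f, measurable A -> `|wfs_delta A f| <= C%:C * `|f| }.

Context {X : normedModType R[i]} (D : wide_function_space X).

Lemma wfs_delta_bounded_linear (A : set Omega) :
  measurable A -> D A \in bounded_linear X X.
Proof.
move=> mA; apply/bounded_linearP; split; first exact: wfs_delta_linear.
by have [C _ DC] := wfs_delta_bounded D; exists C => x; exact: DC.
Qed.

(* Delta_X(A, .) as an element of L(X, X); 0 by convention off the
   sigma-algebra. *)
Definition delta_op (A : set Omega) : bop X X :=
  if pselect (measurable A) is left mA then BOp (wfs_delta_bounded_linear mA)
  else 0.

Lemma delta_opE (A : set Omega) : measurable A -> delta_op A = D A :> (X -> X).
Proof. by move=> mA; rewrite /delta_op; case: pselect. Qed.

Definition absolutely_continuous_op {Y : normedModType R[i]} (T : bop X Y) :=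
  forall e : R, 0 < e -> exists2 delta : R, 0 < delta &
    forall A, measurable A -> (mu A < delta%:E)%E ->
      `|bop_comp T (delta_op A)| < e%:C.

Definition finitely_additive (nu : set Omega -> R[i]^o) :=
  forall A B, measurable A -> measurable B -> A `&` B = set0 ->
    nu (A `|` B) = nu A + nu B.

Definition mu_countably_additive (nu : set Omega -> R[i]^o) :=
  finitely_additive nu /\
  forall A : (set Omega)^nat, (forall k, measurable (A k)) ->
    trivIset setT A -> (mu (\bigcup_k A k) < +oo)%E ->
    series (nu \o A) @ \oo --> nu (\bigcup_k A k).

Definition pointwise_weakstar_ac {Y : normedModType R[i]}
    (S : bop (dual (dual X)) (dual (dual Y))) :=
  forall (f : dual (dual X)) (y' : dual Y),
    mu_countably_additive (fun A => S (biadjoint (delta_op A) f) y').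

End WideFunctionSpace.

(* Main.v *)
Require Import Defs.
From HB Require Import structures.
From mathcomp Require Import all_boot all_order all_algebra.
From mathcomp Require Import all_classical all_reals all_analysis.
From mathcomp Require Import ring lra.

Import Order.TTheory GRing.Theory Num.Theory.
Import numFieldNormedType.Exports.

Local Open Scope classical_set_scope.
Local Open Scope ring_scope.

(** If [T] is not absolutely continuous, there are sets [A_n] with
    [mu A_n <= 2^-(n+1)] and vectors [h_n = Delta(A_n, h_n)] of the unit ball
    with [|T h_n|] bounded below. Fix a free ultrafilter [U] on the integers.
    By compactness [T h_n] converges along [U] to some [y <> 0], and
    Hahn-Banach gives [y'] in the dual of [Y] with [y' y <> 0]. Let [f] in the
    bidual of [X] be the weak-* limit of [h_n] along [U], and put
    [nu E = <y', T** (Delta**(E, f))> = lim_U y' (T (Delta(E, h_n)))]. The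
    unions [B_m] of the [A_k], [k >= m], decrease to a null set, so
    [nu B_m --> 0] by countable additivity; but [Delta(B_m, h_n) = h_n] as soon
    as [n >= m], so [nu B_m = y' y] for all [m]. *)

Local Open Scope complex_scope.

(** * Sublinear functionals and the Hahn-Banach theorem over the reals *)

Section Sublinear.
Context {R : realType} {V : lmodType R[i]}.
Implicit Types (p q : V -> R) (x y z : V).

(** Only real scalars [c%:C] occur: the complex space [V] is treated as a real one. *)
Definition sublinear p := (forall x y, p (x + y) <= p x + p y) /\
  forall (c : R) x, 0 <= c -> p (c%:C *: x) <= c * p x.

Lemma sublinear0 p : sublinear p -> p 0 = 0.
Proof.
move=> [pD pZ]; apply/eqP; rewrite eq_le; apply/andP; split.
  by have := pZ 0 0 (lexx 0); rewrite scaler0 mul0r.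
by have := pD 0 0; rewrite addr0 lerDl.
Qed.

Lemma sublinearZ p (c : R) x : sublinear p -> 0 <= c ->
  p (c%:C *: x) = c * p x.
Proof.
move=> sp; rewrite le_eqVlt => /predU1P[<-|c0].
  by rewrite scale0r sublinear0// mul0r.
apply/eqP; rewrite eq_le (sp.2 _ _ (ltW c0))/=.
have := sp.2 c^-1 (c%:C *: x); rewrite invr_ge0 ltW// => /(_ isT).
rewrite scalerA -rmorphM/= mulVf ?gt_eqF// scale1r.
by rewrite ler_pdivlMl.
Qed.

Lemma sublinear_geN p x : sublinear p -> - p (- x) <= p x.
Proof.
by move=> sp; have := sp.1 (- x) x; rewrite addNr sublinear0//; lra.
Qed.

Lemma le_addinf (A B : set R) (c : R) : A !=set0 -> B !=set0 ->
  (forall a b, A a -> B b -> c <= a + b) -> c <= inf A + inf B.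
Proof.
move=> A0 B0 cAB; rewrite -lerBlDr; apply: lb_le_inf => // a Aa.
rewrite lerBlDr -lerBlDl; apply: lb_le_inf => // b Bb.
by rewrite lerBlDl cAB.
Qed.

Lemma le_mulinf (A : set R) (c k : R) : 0 <= c -> A !=set0 ->
  (forall a, A a -> k <= c * a) -> k <= c * inf A.
Proof.
rewrite le_eqVlt => /predU1P[<- [a Aa] /(_ a Aa)|c0 A0 kA].
  by rewrite !mul0r.
rewrite -ler_pdivrMl//; apply: lb_le_inf => // a Aa.
by rewrite ler_pdivrMl// kA.
Qed.

(** The usual auxiliary functional for Hahn-Banach: [t = 0] shows that it lies below [p], and
    [t = 1] that its value at [- z] is at most [- p z]. *)
Definition sublinear_shift p z x : R :=
  inf [set p (x + t%:C *: z) - t * p z | t in [set t : R | 0 <= t]].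

Lemma sublinear_shift_le p z x (t : R) : sublinear p -> 0 <= t ->
  sublinear_shift p z x <= p (x + t%:C *: z) - t * p z.
Proof.
move=> sp t0; apply: ge_inf; last by exists t.
(* A lower bound, since [s * p z = p (s z) <= p (x + s z) + p (- x)]. *)
exists (- p (- x)) => _ [s /= s0 <-].
rewrite -sublinearZ//.
by have := sp.1 (x + s%:C *: z) (- x); rewrite addrAC subrr add0r; lra.
Qed.

(** Parameters [s] for [x] and [t] for [y] combine to [s + t] for [x + y], and [t] for [x] becomes
    [c * t] for [c x]; infima are then taken on the right. *)
Lemma sublinear_shiftP p z : sublinear p -> sublinear (sublinear_shift p z).
Proof.
move=> sp; have E0 x : [set p (x + t%:C *: z) - t * p z
    | t in [set t : R | 0 <= t]] !=set0.
  by exists (p (x + 0%:C *: z) - 0 * p z), 0 => /=.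
split=> [x y|c x c0].
  apply: le_addinf => // _ _ [s /= s0 <-] [t /= t0 <-].
  apply: (le_trans (@sublinear_shift_le p z _ (s + t) sp _)).
    exact: addr_ge0.
  rewrite rmorphD/= scalerDl addrACA.
  have := sp.1 (x + s%:C *: z) (y + t%:C *: z).
  lra.
apply: le_mulinf => // _ [t /= t0 <-].
apply: (le_trans (@sublinear_shift_le p z _ (c * t) sp _)).
  exact: mulr_ge0.
rewrite mulrBr mulrA lerB// rmorphM/= -scalerA -scalerDr.
exact: sp.2.
Qed.

(** Zorn's lemma for the reversed pointwise order on the sublinear functionals below [q]; a nonempty
    chain is bounded by its pointwise infimum. *)
Lemma minimal_sublinear q : sublinear q -> exists p,
  [/\ sublinear p, forall x, p x <= q x &
      forall r, sublinear r -> (forall x, r x <= p x) -> r = p].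
Proof.
move=> sq.
pose T := {p : V -> R | sublinear p /\ forall x, p x <= q x}.
pose rel (r s : T) := `[< forall x, sval s x <= sval r x >].
have [|||F Ftot|[p [sp pq]] pmin] := @Zorn T rel.
- by move=> r; apply/asboolP.
- move=> r s t /asboolP rs /asboolP st; apply/asboolP => x.
  exact: le_trans (st x) (rs x).
- move=> [r hr] [s hs] /asboolP/= rs /asboolP/= sr.
  by apply/eq_exist/funext => x; apply/eqP; rewrite eq_le rs sr.
- have [[r0 Fr0]|F0] := pselect (F !=set0); last first.
    exists (exist _ q (conj sq (fun x => lexx _))) => s Fs.
    by case: F0; exists s.
  pose E x := [set sval r x | r in F].
  have E0 x : E x !=set0 by exists (sval r0 x), r0.
  have Elb x : has_lbound (E x).
    (* Every member satisfies [r x >= - r (- x) >= - q (- x)], so the infimum is finite. *)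
    exists (- q (- x)) => _ [[r [sr rq]] Fr <-] /=.
    by rewrite (le_trans _ (sublinear_geN r x sr))// lerN2.
  pose g x := inf (E x).
  have gle r x : F r -> g x <= sval r x.
    by move=> Fr; apply: ge_inf => //; exists r.
  have sg : sublinear g.
    split=> [x y|c x c0].
      apply: le_addinf => // _ _ [r Fr <-] [s Fs <-].
      (* The smaller of [r] and [s] is subadditive and bounds [g (x + y)]; this is where totality of
         the chain enters. *)
      have [/asboolP rs|/asboolP sr] := Ftot _ _ Fr Fs.
        rewrite (le_trans (gle _ _ Fs))// (le_trans ((svalP s).1.1 _ _))//.
        by rewrite lerD2r.
      rewrite (le_trans (gle _ _ Fr))// (le_trans ((svalP r).1.1 _ _))//.
      by rewrite lerD2l.
    apply: le_mulinf => // _ [r Fr <-].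
    by rewrite (le_trans (gle _ _ Fr))// (svalP r).1.2.
  have gq x : g x <= q x := le_trans (gle _ _ Fr0) ((svalP r0).2 x).
  exists (exist _ g (conj sg gq)) => s Fs; apply/asboolP => x.
  exact: gle.
exists p; split => // r sr rp.
have rq x : r x <= q x := le_trans (rp x) (pq x).
have := pmin (exist _ r (conj sr rq)).
by move=> /(_ (asboolT rp)) [].
Qed.

(* A minimal sublinear functional [p] equals its shifts, and the shift along
   [z] takes a value at most [- p z] at [- z]; hence [p] is odd. *)
Lemma hahn_banach_sublinear q z : sublinear q -> exists u : V -> R,
  [/\ {morph u : x y / x + y}, forall (c : R) x, u (c%:C *: x) = c * u x,
      forall x, u x <= q x & q z <= u z].
Proof.
move=> sq.
(* Minimizing below the shift of [q], rather than below [q], forces [p (- z) <= - q z], which by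
   oddness is [q z <= p z]. *)
have [p [sp pq pmin]] := minimal_sublinear _ (sublinear_shiftP q z sq).
have shift_le r y x : sublinear r -> sublinear_shift r y x <= r x.
  move=> sr; rewrite (le_trans (sublinear_shift_le r y x 0 sr _))//.
  by rewrite scale0r addr0 mul0r subr0.
have shiftN r y : sublinear r -> sublinear_shift r y (- y) <= - r y.
  move=> sr; rewrite (le_trans (sublinear_shift_le r y _ 1 sr _))//.
  by rewrite scale1r addNr sublinear0// mul1r sub0r.
have pN x : p (- x) = - p x.
  apply/eqP; rewrite eq_le [X in _ && X]lerNl sublinear_geN// andbT.
  have {1}<- := pmin _ (sublinear_shiftP p x sp) (fun y => shift_le p x y sp).
  exact: shiftN.
exists p; split.
- move=> x y; apply/eqP; rewrite eq_le sp.1/=.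
  have := sp.1 (x + y) (- y); rewrite addrK pN; lra.
- move=> c x; have [c0|c0] := leP 0 c; first exact: sublinearZ.
  rewrite -[c]opprK rmorphN/= scaleNr pN sublinearZ ?mulNr//.
  by rewrite oppr_ge0 ltW.
- by move=> x; rewrite (le_trans (pq x))// shift_le.
- by rewrite -lerN2 -pN (le_trans (pq _))// shiftN.
Qed.

End Sublinear.

(** * Continuity from above of countably additive set functions *)

Section MuCountablyAdditive.
Context {d : measure_display} {Omega : measurableType d} {R : realType}.
Context (mu : {measure set Omega -> \bar R}).

(** The differences [C k] are disjoint with union [B 0] minus the intersection, a set of finite
    measure, and their series telescopes to [nu (B 0) - nu (B n)]. *)
Lemma mu_countably_additive_nonincreasing_cvg (nu : set Omega -> R[i]^o)
    (B : (set Omega)^nat) :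
  mu_countably_additive mu nu -> (forall k, measurable (B k)) ->
  nonincreasing_seq B -> (mu (B 0%N) < +oo)%E ->
  nu (B k) @[k --> \oo] --> nu (\bigcap_k B k).
Proof.
move=> [nuU nuS] mB niB B0oo.
have subB i j : (i <= j)%N -> B j `<=` B i by move=> ij; apply/subsetPset/niB.
pose C k := B k `\` B k.+1.
have mC k : measurable (C k) by exact: measurableD.
have mN : measurable (\bigcap_k B k) by exact: bigcapT_measurable.
have nuD (E F : set Omega) : measurable E -> measurable F -> F `<=` E ->
    nu (E `\` F) = nu E - nu F.
  move=> mE mF FE; rewrite -[X in nu X - _](setDUK FE).
  rewrite nuU ?setDIK//; last exact: measurableD.
  by rewrite addrAC subrr add0r.
have bigC : \bigcup_k C k = B 0%N `\` \bigcap_k B k.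
  apply/seteqP; split=> [x [k _ [Bkx nBkx]]|x [B0x nBx]].
    by split; [exact: subB Bkx|move=> /(_ k.+1 I)].
  (* A point of [B 0] that lies in no [C k] stays in every [B k], by induction. *)
  apply: contrapT => nC; apply: nBx => k _; elim: k => // k Bkx.
  by apply: contrapT => nBkx; apply: nC; exists k.
have seriesC n : series (nu \o C) n = nu (B 0%N) - nu (B n).
  elim: n => [|n IHn]; first by rewrite /series/= big_geq// subrr.
  rewrite seriesSr IHn /= nuD//; last exact: subB.
  by rewrite addrA subrK.
have trivC : trivIset setT C.
  apply: ltn_trivIset => n m mn; apply/seteqP; split=> // x [[_ nB] [Bx _]].
  exact/nB/(subB _ _ mn).
have Coo : (mu (\bigcup_k C k) < +oo)%E.
  rewrite bigC; apply: le_lt_trans B0oo; apply: le_measure; rewrite ?inE//.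
  exact: measurableD.
have nuC : nu (\bigcup_k C k) = nu (B 0%N) - nu (\bigcap_k B k).
  by rewrite bigC; apply: nuD => // x; apply.
have BE k : nu (B k) = nu (B 0%N) - series (nu \o C) k.
  by rewrite seriesC opprB addrCA subrr addr0.
have -> : nu (\bigcap_k B k) = nu (B 0%N) - nu (\bigcup_k C k).
  by rewrite nuC opprB addrCA subrr addr0.
under eq_fun do rewrite BE.
exact: cvgB (cvg_cst _) (nuS C mC trivC Coo).
Qed.

End MuCountablyAdditive.

(** * Limits along ultrafilters and weak-* compactness *)

Section UltraLimits.

(** Maximality comes from the dichotomy for [U]: if the preimage of [A] is not in [U], that of its
    complement is, and a proper filter cannot contain both. *)
Lemma fmap_ultra {I T : Type} (u : I -> T) (U : set_system I) :
  UltraFilter U -> UltraFilter (u @ U).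
Proof.
move=> UU; split; first exact: fmap_proper_filter.
move=> G PG sG; apply/seteqP; split=> [A GA|//].
have [//|UnA] := @in_ultra_setVsetC I U (u @^-1` A) UU.
by have [x []] := filter_ex (filterI GA (sG (~` A) UnA)).
Qed.

Lemma ultra_compact_cvg {I : Type} {T : topologicalType} (K : set T)
    (u : I -> T) (U : set_system I) :
  UltraFilter U -> compact K -> (forall i, K (u i)) ->
  exists2 l, K l & u @ U --> l.
Proof.
move=> UU; rewrite compact_ultra => cK Ku.
have [|l [Kl ul]] := cK (u @ U) (fmap_ultra u U UU); last by exists l.
by apply: (@filterE _ U) => i; exact: Ku.
Qed.

Context {R : realType}.

Lemma real_complex_continuous : continuous (fun x : R => x%:C : R[i]^o).
Proof.
move=> x; apply/cvgrPdist_lt => -[a b]; rewrite ltcE /= => /andP[/eqP -> a0].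
near=> y; rewrite -rmorphB /= normc_def /= expr0n addr0 sqrtr_sqr ltcR.
by near: y; apply: cvgr_dist_lt.
Unshelve. all: by end_near. Qed.

(** The disc of radius [M] lies in the square of side [2 M], a continuous image of a product of two
    segments. *)
Lemma bounded_complex_in_compact (M : R) : exists2 K : set R[i]^o,
  compact K & forall z : R[i]^o, `|z| <= M%:C -> K z.
Proof.
pose f (z : R * R) : R[i]^o := z.1%:C + 'i%C * z.2%:C.
exists (f @` (`[- M, M]%classic `*` `[- M, M]%classic)).
  apply: continuous_compact; last by apply: compact_setX; exact: segment_compact.
  apply: continuous_subspaceT => z.
  apply: cvgD.
    by apply: continuous_comp; [exact: cvg_fst|exact: real_complex_continuous].
  apply: cvgM; first exact: cvg_cst.
  by apply: continuous_comp; [exact: cvg_snd|exact: real_complex_continuous].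
move=> z zM; exists (complex.Re z, complex.Im z); last by rewrite /f -complexE.
have := le_trans (normc_ge_Re z) zM; rewrite lecR ler_norml => rM.
have : `|complex.Im z|%:C <= M%:C.
  rewrite (le_trans _ zM)// normc_def lecR -[leLHS]sqrtr_sqr ler_wsqrtr//.
  by rewrite lerDr sqr_ge0.
rewrite lecR ler_norml => iM.
by split; rewrite /= in_itv.
Qed.

Lemma ler_norm_cvg {I : Type} {V : normedModType R[i]} (U : set_system I)
    {PU : ProperFilter U} (u : I -> V) (l : V) (M : R) :
  u @ U --> l -> (forall i, `|u i| <= M%:C) -> `|l| <= M%:C.
Proof.
move=> ul uM; rewrite real_leNgt ?normr_real ?complex_real//.
apply/negP => Ml; have [j] := filter_ex (cvgr_norm_gt _ ul _ Ml).
by apply/negP; rewrite -real_leNgt ?normr_real ?complex_real.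
Qed.

Lemma bop_continuous {X Y : normedModType R[i]} (f : bop X Y) : continuous f.
Proof.
apply: bounded_linear_continuous; apply/linear_boundedP.
exists (bop_norm f)%:C; split; first by rewrite complex_real.
by move=> r /ltW fr x; rewrite (le_trans (le_bop_norm _ _))// ler_wpM2r.
Qed.

(** The scalars [phi (g i)] stay in a compact set depending on [phi], so the single ultrafilter [U]
    makes them converge for all [phi] at once. Uniqueness of limits gives linearity, and the norm
    bound passes to the limit. *)
Lemma weakstar_ultra_limit {I : Type} {X : normedModType R[i]}
    (U : set_system I) (g : I -> X) :
  UltraFilter U -> (forall i, `|g i| <= 1) ->
  exists f : dual (dual X), forall phi : dual X, phi (g i) @[i --> U] --> f phi.
Proof.
move=> UU g1.
have phiM (phi : dual X) i : `|phi (g i)| <= (bop_norm phi)%:C.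
  by rewrite (le_trans (le_bop_norm _ _))// ler_piMr// (lecR 0) bop_norm_ge0.
pose f (phi : dual X) : R[i]^o := lim (phi (g i) @[i --> U]).
have cvgf (phi : dual X) : phi (g i) @[i --> U] --> f phi.
  have [K cK KM] := bounded_complex_in_compact (bop_norm phi).
  have [l _ ul] := ultra_compact_cvg K (fun i => phi (g i)) U UU cK
    (fun i => KM _ (phiM phi i)).
  exact: cvgP ul.
have fP : f \in bounded_linear (dual X) R[i]^o.
  apply/bounded_linearP; split=> [a phi psi|].
    have lim_lin : a *: phi (g i) + psi (g i) @[i --> U] --> a *: f phi + f psi.
      exact: cvgD (cvgZl_tmp (k := a) (cvgf phi)) (cvgf psi).
    exact: norm_cvg_lim lim_lin.
  exists 1 => phi; rewrite mul1r bop_normE.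
  exact: ler_norm_cvg (cvgf phi) (phiM phi).
by exists (BOp fP).
Qed.

End UltraLimits.

(** * Separation of points by the complex dual *)

(* A real functional [u] is the real part of the complex functional
   [x |-> u x - i u (i x)]. *)
Lemma dual_separates_points {R : realType} {Y : normedModType R[i]} (y : Y) :
  y != 0 -> exists phi : dual Y, phi y != 0.
Proof.
move=> y0; pose q (x : Y) := complex.Re `|x|.
have qE x : (q x)%:C = `|x| by exact: normc_real.
have sq : sublinear q.
  split=> [x z|c x c0].
    by rewrite -lecR rmorphD /= !qE ler_normD.
  by rewrite -lecR rmorphM/= !qE normrZ ger0_norm// (lecR 0).
have [u [uD uZ uq qu]] := hahn_banach_sublinear q y sq.
have uN x : u (- x) = - u x.
  by rewrite -scaleN1r -(rmorphN1 (real_complex R)) uZ mulN1r.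
have u_bound x : `|u x| <= q x.
  rewrite ler_norml uq andbT lerNl -uN (le_trans (uq _))//.
  by rewrite /q normrN.
pose phi (x : Y) : R[i]^o := (u x)%:C - 'i%C * (u ('i%C *: x))%:C.
have phiP : phi \in bounded_linear Y R[i]^o.
  apply/bounded_linearP; split=> [a x z|].
    have uZC (w : Y) :
        u (a *: w) = complex.Re a * u w + complex.Im a * u ('i%C *: w).
      by rewrite {1}(complexE a) scalerDl uD uZ ['i%C * _]mulrC -scalerA uZ.
    rewrite /phi scalerDr !uD scalerA [('i%C * a)]mulrC -scalerA !uZC.
    (* After [i * i = -1], complex linearity is a comparison of real and imaginary parts. *)
    rewrite scalerA -expr2 sqr_i scaleN1r uN.
    apply/eqP; rewrite eq_complex; case: a {uZC} => a b /=.
    apply/andP; split; apply/eqP => /=; ring.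
  (* The crude bound 2 adds the contributions of [u x] and [u (i x)]. *)
  exists (1 + 1) => x; rewrite rmorphD /= mulrDl mul1r.
  have norm_i : `|'i%C : R[i]| = 1.
    by rewrite normc_def /= expr0n expr1n add0r sqrtr1.
  have le_u z : `|(u z)%:C| <= `|z|.
    by rewrite normc_def /= expr0n addr0 sqrtr_sqr -qE lecR u_bound.
  rewrite (le_trans (ler_normB _ _))// normrM norm_i mul1r lerD//.
  by rewrite (le_trans (le_u _))// normrZ norm_i mul1r.
exists (BOp phiP); rewrite /= /phi.
(* The real part of [phi y] is [u y], which is at least the norm of [y]. *)
apply: contraNneq y0 => /(congr1 (@complex.Re R)) /=.
rewrite !(mul0r, mulr0, mul1r, subr0) => uy0.
rewrite -normr_le0 -qE -(rmorph0 (real_complex R)) lecR.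
by rewrite (le_trans qu)// -uy0; lra.
Qed.

(** * Absolute continuity of compact operators *)

Theorem proposition3 (d : measure_display) (Omega : measurableType d)
    (R : realType) (mu : {measure set Omega -> \bar R})
    (X Y : completeNormedModType R[i]) (D : wide_function_space mu X)
    (T : bop X Y) :
  compact_operator T ->
  pointwise_weakstar_ac D (biadjoint T) ->
  absolutely_continuous_op D T.
Proof.
move=> cT wT; apply: contrapT => nac.
have [e e0 Abig] : exists2 e : R, 0 < e & forall n : nat, exists A,
    [/\ measurable A, (mu A <= (1 / (2 ^ n.+1)%:R)%:E)%E &
        e%:C <= `|bop_comp T (delta_op D A)|].
  move/existsNP : nac => [e /not_implyP[e0 /forall2NP nac]]; exists e => // n.
  have [|/existsNP[A /not_implyP[mA /not_implyP[muA eA]]]] :=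
    nac (1 / (2 ^ n.+1)%:R).
    by case; rewrite divr_gt0// ltr0n expn_gt0.
  exists A; split=> //; first exact: ltW.
  by move/negP: eA; rewrite -real_leNgt ?normr_real ?complex_real.
have [C C0 DC] := wfs_delta_bounded D.
have [A /all_and3[mA muA eA]] := choice Abig.
(* Halving [e] allows for an operator norm that is not attained on the unit ball; dividing by [C]
   brings [D (A n) f] back into that ball. *)
pose e' := e / 2 / C.
have e'0 : 0 < e' by rewrite !divr_gt0.
have /choice[h /all_and3[h1 hD hT]] : forall n, exists h : X,
    [/\ `|h| <= 1, D (A n) h = h & e'%:C <= `|T h|].
  move=> n.
  have [f f1 ef] : exists2 f : X, `|f| <= 1 & (e / 2)%:C <= `|T (D (A n) f)|.
    apply: contrapT => nf; have := eA n.
    rewrite bop_normE lecR leNgt => /negP; apply.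
    apply: (@le_lt_trans _ _ (e / 2)); last lra.
    apply: bop_norm_le => f f1; rewrite /= delta_opE//.
    rewrite real_leNgt ?normr_real ?complex_real//; apply/negP => ef.
    by apply: nf; exists f => //; exact: ltW.
  have CE : `|C^-1%:C| = C^-1%:C by rewrite ger0_norm// (lecR 0) invr_ge0 ltW.
  (* This vector is fixed by [D (A n)], because [D (A n)] is idempotent by property (I). *)
  exists (C^-1%:C *: D (A n) f); split.
  - rewrite normrZ CE; apply: le_trans (ler_wpM2l _ (DC _ f (mA n))) _.
      by rewrite (lecR 0) invr_ge0 ltW.
    by rewrite mulrA -rmorphM/= mulVf ?gt_eqF// mul1r.
  - by rewrite -!delta_opE// linearZ/= !delta_opE// -wfs_deltaI// setIid.
  - rewrite linearZ/= normrZ CE /e' mulrC rmorphM/= ler_wpM2l// (lecR 0).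
    by rewrite invr_ge0 ltW.
(* Since [U] refines [\oo], whatever holds for all large [n] holds along [U]. *)
have [U [UU ooU]] := ultraFilterLemma (_ : ProperFilter (\oo : set_system nat)).
have [y _ Thy] : exists2 y, closure (T @` [set x | `|x| <= 1]) y &
    T (h n) @[n --> U] --> y.
  apply: ultra_compact_cvg => [|n]; first by rewrite -precompactE.
  by apply: subset_closure; exists (h n) => //; exact: h1.
have y0 : y != 0.
  (* The lower bound [e'] on the norms of [T (h n)] excludes the limit 0. *)
  apply/eqP => y0; rewrite y0 in Thy.
  have [|n] := filter_ex (cvgr_norm_lt _ Thy e'%:C _).
    by rewrite normr0 (ltcR 0).
  by apply/negP; rewrite -real_leNgt ?normr_real ?complex_real.
have [y' y'y] := dual_separates_points y y0.
have [f fP] := weakstar_ultra_limit U h UU h1.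
pose nu := fun E => biadjoint T (biadjoint (delta_op D E) f) y'.
have nuE E : measurable E -> y' (T (D E (h n))) @[n --> U] --> nu E.
  move=> mE; have := fP (bop_comp (bop_comp y' T) (delta_op D E)).
  by rewrite /= delta_opE.
pose B m := \bigcup_(k >= m) A k.
have mB m : measurable (B m) by exact: bigcup_measurable.
have nuB m : nu (B m) = y' y.
  rewrite -(norm_cvg_lim (nuE _ (mB m))); apply: norm_cvg_lim.
  have : y' (T (h n)) @[n --> U] --> y' y.
    by apply: continuous_cvg => //; exact: bop_continuous.
  apply: cvg_trans; apply: near_eq_cvg; apply: ooU.
  near=> n; have -> // : D (B m) (h n) = h n.
  (* For [n >= m] the set [A n] lies in [B m], so [D (B m)] fixes [h n = D (A n) (h n)]. *)
  rewrite -[X in D _ X](hD n) -wfs_deltaI// setIidr ?hD//.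
  by apply: bigcup_sup; near: n; exact: nbhs_infty_ge.
(* The bounds [1 / 2 ^ n.+1] sum to 1. This finite sum serves both for Borel-Cantelli and for the
   finiteness of [mu (B 0)]. *)
have summ : (\sum_(n <oo) mu (A n) < +oo)%E.
  apply: (@le_lt_trans _ _ 1%E); last exact: ltry.
  apply: le_trans (epsilon_trick0 xpredT ler01); exact: lee_nneseries.
have nu0 : nu (\bigcap_k B k) = 0.
  have mN : measurable (\bigcap_k B k) by exact: bigcapT_measurable.
  rewrite -(norm_cvg_lim (nuE _ mN)); apply: norm_cvg_lim.
  apply: cvg_near_cst; apply: ooU; near=> n.
  rewrite wfs_delta_null ?linear0//.
  (* Borel-Cantelli: the intersection of the [B k] is the upper limit of the [A n], hence a null
     set. *)
  exact: lim_sup_set_cvg0 summ.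
have niB : nonincreasing_seq B.
  move=> m n mn; apply/subsetPset; apply: bigcup_subset => k /=.
  exact: leq_trans.
have B0oo : (mu (B 0%N) < +oo)%E.
  apply: le_lt_trans summ; apply: measure_sigma_subadditive => // x [k _ Akx].
  by exists k.
have nuB_cvg :=
  mu_countably_additive_nonincreasing_cvg mu nu B (wT f y') mB niB B0oo.
move/eqP: y'y; apply; rewrite -nu0 -(norm_cvg_lim nuB_cvg).
apply/esym/norm_cvg_lim; under eq_fun do rewrite nuB.
exact: cvg_cst.
Unshelve. all: by end_near. Qed.
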